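(* For any $\mu\in M(X,m)$ and any real $t>\tau(\mu)$ there exist a neighborhood $O(\mu)$ of $\mu$ in $M(X,m)$ in the *-weak topology and a (large enough) number $C(t,\mu)$ such that for all $f\in L^1(X,m)$ and all $n\in\mathbb N$ $$\int_{X_n(O(\mu))}f\circ\alpha^n\,dm\le C(t,\mu)\,e^{nt}\int_X|f|\,dm.$$
   Context: Setting: $(X,\mathfrak A)$ is a measurable space with a $\sigma$-finite measure $m$, and $\alpha:X\to X$ is a measurable mapping. The shift operator $Af=f\circ\alpha$ is assumed to be bounded on the real space $L^1(X,m)$; equivalently there is a constant $C$ with $m(\alpha^{-1}(G))\le C\,m(G)$ for all $G\in\mathfrak A$. $L^\infty(X,m)$ is the space of essentially bounded real-valued functions. $M(X,m)$ is the set of all positive normalized linear functionals $\mu$ on $L^\infty(X,m)$ (positive: $\mu(f)\ge0$ for $f\ge0$; normalized: $\mu(1)=1$), equipped with the *-weak topology of the dual space of $L^\infty(X,m)$. A measurable partition of unity on $X$ is a finite set $D=\{g_1,\dots,g_k\}$ of nonnegative functions $g_i\in L^\infty(X,m)$ with $g_1+\dots+g_k\equiv1$ almost everywhere. $t$-entropy: for $\mu\in M(X,m)$, $$\tau(\mu)=\inf_{n\in\mathbb N}\frac{\tau_n(\mu)}n,\qquad \tau_n(\mu)=\inf_D\tau_n(\mu,D),\qquad \tau_n(\mu,D)=\sup_{\|f\|=1}\sum_{g\in D}\mu(g)\ln\frac{\int_X g\,|f\circ\alpha^n|\,dm}{\mu(g)},$$ where the infimum is over all measurable partitions of unity $D$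 on $X$ and the supremum over all $f\in L^1(X,m)$ with $\|f\|=1$. If $\mu(g)=0$ the corresponding summand is taken to be $0$ regardless of the integral; if some $g\in D$ has $\int_X g\,dm=0$ and $\mu(g)>0$, then $\tau(\mu)=-\infty$. Values lie in $[-\infty,\infty)$, with $\ln0=-\infty$. Empirical measures: for $x\in X$, $n\in\mathbb N$, $f\in L^\infty(X,m)$, $$\delta_{x,n}(f)=\frac1n S_nf(x)=\frac1n\bigl(f(x)+f(\alpha(x))+\dots+f(\alpha^{n-1}(x))\bigr),$$ which, as a function of $x$, is an element of $L^\infty(X,m)$, hence defined up to a null set. For a neighborhood $O(\mu)$ put $X_n(O(\mu))=\{x\in X\mid\delta_{x,n}\in O(\mu)\}$, defined up to a set of $m$-measure zero. Concretely, neighborhoods here are determined by finitely many functions: for $O(\mu)=\{\nu\in M(X,m)\mid(\nu(g_1),\dots,\nu(g_k))\in W\}$ with $g_1,\dots,g_k\in L^\infty(X,m)$ and $W\subset\mathbb R^k$ open, $X_n(O(\mu))=\{x\mid(\tfrac1nS_ng_1(x),\dots,\tfrac1nS_ng_k(x))\in W\}$, with arbitrary representatives of the $g_i$ chosen. *)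

(* Defs.v *)
From HB Require Import structures.
From mathcomp Require Import all_boot all_order all_algebra finmap.
From mathcomp Require Import all_classical all_reals all_analysis ess_sup_inf.

Set Implicit Arguments.
Unset Strict Implicit.
Unset Printing Implicit Defensive.

Import Order.TTheory GRing.Theory Num.Theory.
Import numFieldNormedType.Exports.

Local Open Scope classical_set_scope.
Local Open Scope ring_scope.

Section t_entropy.
Context (d : measure_display) (X : measurableType d) (R : realType).
Variable m : {measure set X -> \bar R}.

(* Elements of [L1] and [Linfty] are functions, not classes modulo equality
   almost everywhere; see [state_ae_eq] for the functionals on [Linfty]. *)
Definition L1 := LfunType m (@lexx _ _ 1%E).

Definition Linfty := LfunType m (@leey _ 1%E).

Lemma Linfty_cst1_subproof : (cst 1 : X -> R) \in Lfun m +oo%E.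
Proof.
rewrite inE; apply/andP; split; rewrite inE/=; first exact: measurable_cst.
rewrite /finite_norm unlock; case: ifPn => [m0|_]; last exact: ltry.
rewrite [X in ess_sup _ X](_ : _ = cst 1%E); first by rewrite ess_sup_cst ?ltry.
by apply/funext => x /=; rewrite normr1.
Qed.

Definition Linfty_one : Linfty := Lfun_Sub (@leey _ 1%E) Linfty_cst1_subproof.

(* As [states] is a set of the space of pointwise convergence
   [{ptws Linfty -> R}], the topology that the library puts on the type of its
   elements is the *-weak topology. *)
Definition states : set {ptws Linfty -> R} :=
  [set mu | [/\ scalar (mu : Linfty -> R),
                forall f : Linfty, (\forall x \ae m, 0 <= f x) -> 0 <= mu f &
                mu Linfty_one = 1]].

Lemma state_ae_eq (mu : states) (f g : Linfty) :
  (\forall x \ae m, f x = g x) -> \val mu f = \val mu g.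
Proof.
move=> fg; have [lin pos _] := set_valP mu.
have sub (u v : Linfty) : (\forall x \ae m, u x = v x) ->
    0 <= \val mu u - \val mu v.
  move=> uv; have : 0 <= \val mu (-1 *: v + u).
    apply: pos; apply: filterS uv => x uvx.
    have -> : (-1 *: v + u : Linfty) x = -1 * v x + u x by [].
    by rewrite uvx mulN1r addNr.
  by rewrite [\val mu _](lin (-1) v u) mulN1r addrC.
apply: le_anti; apply/andP; split; rewrite -subr_ge0.
  by apply: (sub g f); apply: filterS fg => x ->.
exact: (sub f g).
Qed.

Definition shift_bounded (alpha : X -> X) : Prop :=
  exists C : R, forall f : L1,
    ('N[m]_1[EFin \o (f \o alpha)] <= C%:E * 'N[m]_1[EFin \o f])%E.

Definition partition_of_unity (D : {fset Linfty}) : Prop :=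
  (forall g : Linfty, g \in D -> \forall x \ae m, 0 <= g x) /\
  (\forall x \ae m, \sum_(g <- D) (g : X -> R) x = 1).

Definition tau_summand (alpha : X -> X) (n : nat) (mu : Linfty -> R)
    (f : L1) (g : Linfty) : \bar R :=
  if mu g == 0 then 0%:E
  else ((mu g)%:E *
        lne ((\int[m]_x (g x * `|f (iter n alpha x)|)%:E) * ((mu g)^-1)%:E))%E.

Definition tau_nD (alpha : X -> X) (n : nat) (mu : Linfty -> R)
    (D : {fset Linfty}) : \bar R :=
  ereal_sup [set (\sum_(g <- D) tau_summand alpha n mu f g)%E
            | f in [set f : L1 | 'N[m]_1[EFin \o f]%E = 1%E]].

Definition tau_n (alpha : X -> X) (n : nat) (mu : Linfty -> R) : \bar R :=
  ereal_inf [set tau_nD alpha n mu D | D in partition_of_unity].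

Definition tau (alpha : X -> X) (mu : Linfty -> R) : \bar R :=
  ereal_inf [set (tau_n alpha n mu * (n%:R^-1)%:E)%E | n in [set n | (0 < n)%N]].

(* [empirical alpha n x g] is delta_{x,n}(g), meant for n > 0. *)
Definition empirical (alpha : X -> X) (n : nat) (x : X) (g : X -> R) : R :=
  n%:R^-1 * \sum_(i < n) g (iter i alpha x).

Definition cylinder (k : nat) (g : 'I_k -> Linfty) (W : set 'rV[R]_k) :
    set states :=
  [set nu : states | W (\row_i \val nu (g i))].

(* The set X_n(O) for O = [cylinder g W]. *)
Definition empirical_in (alpha : X -> X) (n : nat) (k : nat)
    (g : 'I_k -> Linfty) (W : set 'rV[R]_k) : set X :=
  [set x | W (\row_i empirical alpha n x (g i))].

End t_entropy.

Arguments states {d X R} m _.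

(* Main.v *)
Require Import Defs.
From HB Require Import structures.
From mathcomp Require Import all_boot all_order all_algebra finmap.
From mathcomp Require Import all_classical all_reals all_analysis.
From mathcomp Require Import measurable_realfun ring lra zify.

Set Implicit Arguments.
Unset Strict Implicit.
Unset Printing Implicit Defensive.

Import Order.TTheory GRing.Theory Num.Theory.
Import numFieldNormedType.Exports.

Local Open Scope classical_set_scope.
Local Open Scope ring_scope.

(** The inequality [tau mu < t] is witnessed by one [N > 0] and one partition of
    unity [D] with [tau_N (mu, D) < N t].  For a nonnegative [f] of norm 1, let
    [v_g] be the integral of [g * (f \o alpha^N)], for [g] in [D].  The vectors
    [v] so obtained form a bounded convex set [K], on which the concave function
    [\sum_g mu g * ln (v_g / mu g)] is at most some [S < N t].  At a maximizer
    [u], the first-order condition reads [\sum_g mu g * v_g / u_g <= 1] on [K].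
    So the weights [w_g = mu g / u_g] satisfy [\sum_g w_g * v_g <= 1] on [K] and
    [\sum_g mu g * ln w_g >= - S].  Near maximizers serve as well, and they
    exist without any compactness ([near_maximizer_gradient], [dual_weights]).

    Let [psi = \sum_g ln w_g * g].  As [ln] is concave,
    [expR psi <= \sum_g w_g * g] almost everywhere.  Hence
    [f |-> expR psi * (f \o alpha^N)] is a contraction of L1, whereas
    [- (N t) < mu psi] ([state_contraction]).

    The neighbourhood is [{nu | - (N t) < nu psi}].  On the set of points whose
    empirical measure at time [n] belongs to it, the Birkhoff sum [S_n psi]
    exceeds [- n N t], so that [1 <= expR (n t) * expR (S_n psi / N)].  It remains
    to bound the integral of [expR (S_n psi / N) * (f \o alpha^n)] by a constant
    times the integral of [f] ([integral_birkhoff_le]).  Split [S_n psi] into [N]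
    sums, one for each residue class of times modulo [N].  The exponential of
    the mean of these sums is at most the sum of their exponentials, and the
    exponential of the sum over one class is a product of factors
    [expR psi] taken [N] steps apart, to which the contraction applies again and
    again. *)

(** * Concave maximization over a convex set of vectors *)

(** From [u / (1 + u) <= ln (1 + u)]. *)
Lemma ln1D_ge (R : realType) (u : R) :
  - 2^-1 <= u -> u - 2 * u ^+ 2 <= ln (1 + u).
Proof.
move=> hu; have u1 : 0 < 1 + u by lra.
have hV : ln (1 + u) = - ln ((1 + u)^-1) by rewrite lnV ?opprK// posrE.
rewrite hV lerNr; have -> : (1 + u)^-1 = 1 + (- u / (1 + u)) by field; lra.
apply: le_trans (le_ln1Dx _) _.
  by rewrite ltr_pdivlMr//; lra.
rewrite ler_pdivrMr//.
nra.
Qed.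

(** A convex combination of nonnegative vectors, with positive weights, is
    positive wherever one of them is. *)
Lemma positive_point (R : realType) (I : finType) (P : pred I)
    (K : set (I -> R)) :
  K !=set0 ->
  (forall v, K v -> forall i, 0 <= v i) ->
  (forall s u v, 0 <= s <= 1 -> K u -> K v ->
     K (fun i => (1 - s) * u i + s * v i)) ->
  (forall i, P i -> exists2 v, K v & 0 < v i) ->
  exists2 v, K v & forall i, P i -> 0 < v i.
Proof.
move=> [v0 Kv0] K0 Kc KP.
suff : forall s : seq I, exists2 v, K v & forall i, i \in s -> P i -> 0 < v i.
  by move=> /(_ (enum I))[v Kv vP]; exists v => // i; apply: vP; rewrite mem_enum.
elim=> [|j s [v Kv vP]]; first by exists v0.
have [Pj|nPj] := boolP (P j); last first.
  exists v => // i; rewrite inE => /orP[/eqP-> Pj|]; last exact: vP.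
  by rewrite Pj in nPj.
have [u Ku uj] := KP j Pj.
exists (fun i => (1 - 2^-1) * u i + 2^-1 * v i).
  by apply: Kc => //; lra.
move=> i; rewrite inE => /orP[/eqP->|si] Pi; have := K0 _ Kv; have := K0 _ Ku.
  by move=> _ /(_ j); lra.
by move=> /(_ i); have := vP _ si Pi; lra.
Qed.

(** First-order condition for maximizing [\sum_i p i * ln (v i)], up to [delta].
    Moving from [u] towards [v] by a step [s] gains, to first order,
    [s * (\sum_i p i * (v i / u i) - 1)], with an error of order [s ^+ 2] that is
    uniform because the coordinates lie between [c] and [M].  If [u] is within
    [s * delta / 2] of the supremum, the gain cannot exceed this defect. *)
Lemma near_maximizer_gradient (R : realType) (I : finType) (p : I -> R)
    (K : set (I -> R)) (c M delta : R) :
  (forall i, 0 <= p i) -> \sum_i p i = 1 ->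
  0 < c -> 0 < delta ->
  K !=set0 ->
  (forall s u v, 0 <= s <= 1 -> K u -> K v ->
     K (fun i => (1 - s) * u i + s * v i)) ->
  (forall v i, K v -> 0 < p i -> c <= v i <= M) ->
  exists2 u, K u & forall v, K v -> \sum_i p i * (v i / u i) <= 1 + delta.
Proof.
move=> p0 p1 c0 d0 [u0 Ku0] Kc KcM.
pose phi (v : I -> R) := \sum_i p i * ln (v i).
pose A := [set phi v | v in K].
have supA : has_sup A.
  split; first by exists (phi u0), u0.
  exists (\sum_i p i * ln M) => _ [v Kv <-].
  apply: ler_sum => i _; have := p0 i; rewrite le_eqVlt => /orP[/eqP<-|pi].
    by rewrite !mul0r.
  have /andP[h1 h2] := KcM _ _ Kv pi.
  by rewrite ler_pM2l// ler_ln// posrE; lra.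
(* [B] bounds the relative increments [`|r i|] below, and [s] is chosen so that
   [ln1D_ge] applies and its quadratic term costs at most [s * delta / 2]. *)
pose B := 1 + `|M| / c.
have B1 : 1 <= B by rewrite /B lerDl divr_ge0// ltW.
pose s := Num.min (B^-1 / 2) (delta / (4 * B ^+ 2)).
have s0 : 0 < s.
  by rewrite lt_min !divr_gt0 ?invr_gt0 ?mulr_gt0 ?exprn_gt0//; lra.
have sB : s * B <= 2^-1.
  by rewrite -ler_pdivlMr; [rewrite mulrC ge_min lexx|lra].
have s1 : s <= 1 by nra.
have sd : s * (2 * B ^+ 2) <= delta / 2.
  rewrite -ler_pdivlMr; last by rewrite mulr_gt0// exprn_gt0; lra.
  rewrite /s ge_min; apply/orP; right.
  rewrite le_eqVlt; apply/orP; left; apply/eqP; field; lra.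
have eta0 : 0 < s * delta / 2 by rewrite divr_gt0// mulr_gt0.
have [_ [u Ku <-] hu] := sup_adherent eta0 supA.
exists u => // v Kv.
pose w i := (1 - s) * u i + s * v i.
have Kw : K w by apply: Kc => //; rewrite ltW.
have hw : phi w <= sup A by apply: ub_le_sup; [exact: supA.2|exists w].
pose r i := v i / u i - 1.
have step i : p i * (ln (u i) + (s * r i - 2 * (s * B) ^+ 2)) <= p i * ln (w i).
  have := p0 i; rewrite le_eqVlt => /orP[/eqP<-|pi]; first by rewrite !mul0r.
  rewrite ler_pM2l//.
  have /andP[u1 u2] := KcM _ _ Ku pi.
  have /andP[v1 v2] := KcM _ _ Kv pi.
  have ui0 : 0 < u i by lra.
  have vu0 : 0 < v i / u i by rewrite divr_gt0//; lra.
  have rB : v i / u i <= `|M| / c.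
    apply: ler_pM; rewrite ?invr_ge0; try lra.
      by apply: le_trans v2 _; exact: ler_norm.
    by rewrite lef_pV2// posrE.
  have -> : w i = u i * (1 + s * r i).
    by rewrite /w /r; field; lra.
  have r1 : -1 <= r i by rewrite /r; lra.
  have r2 : r i <= B by rewrite /r /B; lra.
  have sr : - 2^-1 <= s * r i by nra.
  rewrite lnM ?posrE//; last by nra.
  rewrite lerD2l; apply: le_trans (ln1D_ge sr).
  have : 0 <= (s * B - s * r i) * (s * B + s * r i) by apply: mulr_ge0; nra.
  rewrite lerD2l; lra.
have {step} : \sum_i p i * (ln (u i) + (s * r i - 2 * (s * B) ^+ 2)) <= phi w.
  by apply: ler_sum => i _; exact: step.
have -> : \sum_i p i * (ln (u i) + (s * r i - 2 * (s * B) ^+ 2)) =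
    phi u + s * (\sum_i p i * (v i / u i))
      - (s + 2 * (s * B) ^+ 2) * \sum_i p i.
  rewrite /phi !mulr_sumr -big_split/= -sumrB; apply: eq_bigr => i _.
  by rewrite /r; ring.
rewrite p1 mulr1 => hphi.
have : s * (\sum_i p i * (v i / u i)) <= s * (1 + delta) by nra.
by rewrite ler_pM2l.
Qed.

(** Duality: the supremum of [\sum_i p i * ln (v i / p i)] over [K] is also the
    infimum of [- \sum_i p i * ln (w i)] over the positive [w] such that
    [\sum_i w i * v i <= 1] on [K].
    Without a point of [K] that is positive on the support of [p], the supremum
    is [-oo]: some coordinate in the support vanishes on [K], and its weight can
    be arbitrarily large.  Otherwise [K] is contracted slightly towards such a
    point [v0], which keeps the coordinates away from 0, and the weights are
    [p i / u i] for a near maximizer [u], up to a factor near 1, on the support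
    and a small constant off it. *)
Lemma dual_weights (R : realType) (I : finType) (p : I -> R) (K : set (I -> R))
    (M S S' : R) :
  (forall i, 0 <= p i) -> \sum_i p i = 1 ->
  (forall s u v, 0 <= s <= 1 -> K u -> K v ->
     K (fun i => (1 - s) * u i + s * v i)) ->
  (forall v i, K v -> 0 <= v i <= M) ->
  (forall v, K v -> (forall i, 0 < p i -> 0 < v i) ->
     \sum_i p i * ln (v i / p i) <= S) ->
  S < S' ->
  exists w : I -> R, [/\ forall i, 0 < w i,
    forall v, K v -> \sum_i w i * v i <= 1 &
    - S' < \sum_i p i * ln (w i)].
Proof.
move=> p0 p1 Kc KM KS SS'.
(* A weight [Q^-1] on each coordinate contributes at most 1 in total on [K]. *)
pose Q : R := #|I|%:R * `|M| + 1.
have cI : 0 <= #|I|%:R * `|M| by rewrite mulr_ge0.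
have Q0 : 0 < Q by rewrite /Q; lra.
have vM v i : K v -> v i <= `|M|.
  by move=> /(KM _ i)/andP[_ h]; apply: le_trans h (ler_norm _).
have cst_sum (x : R) : \sum_(i : I) x = #|I|%:R * x.
  by rewrite sumr_const mulr_natl.
have [[i pi Ki]|nz] := pselect (exists2 i, 0 < p i & forall v, K v -> v i = 0).
  pose l := ln Q^-1.
  pose w j := if j == i then expR (l + (1 - S' - l) / p i) else Q^-1.
  have w0 j : 0 < w j by rewrite /w; case: ifP; rewrite ?expR_gt0// invr_gt0.
  exists w; split => //.
  - move=> v Kv; apply: (@le_trans _ _ (\sum_(j : I) Q^-1 * `|M|)).
      apply: ler_sum => j _; rewrite /w; case: eqP => [->|_].
        by rewrite (Ki v Kv) mulr0 mulr_ge0// invr_ge0 ltW.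
      by rewrite ler_pM2l ?invr_gt0// vM.
    by rewrite cst_sum mulrCA mulrC ler_pdivrMr// /Q; lra.
  - have -> : \sum_j p j * ln (w j) =
        \sum_j p j * l + p i * ((1 - S' - l) / p i).
      rewrite (bigD1 i)//= [in RHS](bigD1 i)//= /w eqxx expRK.
      rewrite mulrDr -!addrA; congr (_ + _); rewrite addrC; congr (_ + _).
      by apply: eq_bigr => j /negbTE ->.
    rewrite -mulr_suml p1 mul1r mulrCA divff ?mulr1; last by rewrite gt_eqF.
    lra.
have KP i : 0 < p i -> exists2 v, K v & 0 < v i.
  move=> pi; apply: contrapT => H; apply: nz; exists i => // v Kv.
  have /andP[+ _] := KM _ i Kv; rewrite le_eqVlt => /orP[/eqP//|vi].
  by exfalso; apply: H; exists v.
have K_neq0 : K !=set0.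
  have [i pi] : exists i, 0 < p i.
    apply: contrapT => H; have : \sum_i p i <= \sum_(i : I) 0.
      by apply: ler_sum => i _; rewrite leNgt; apply/negP => pi; apply: H; exists i.
    by rewrite p1 big1//; lra.
  by have [v Kv _] := KP i pi; exists v.
have [v0 Kv0 v0P] := @positive_point _ _ (fun i => 0 < p i) _ K_neq0
  (fun v Kv i => proj1 (andP (KM v i Kv))) Kc KP.
(* The factors [1 - s] (contraction towards [v0]) and [1 + 2 * s] (defect of the
   near maximizer and weights off the support) together cost less than
   [S' - S] in the logarithm. *)
pose th := expR (S - S').
have th0 : 0 < th by exact: expR_gt0.
have th1 : th < 1 by rewrite /th expR_lt1; lra.
pose s := (1 - th) / 4.
have s0 : 0 < s by rewrite /s; lra.
have s1 : s < 1 by rewrite /s; lra.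
pose K' := [set (fun i => (1 - s) * v i + s * v0 i) | v in K].
have K'K v : K' v -> K v by move=> [u Ku <-]; apply: Kc => //; lra.
pose c := s * \big[Num.min/1]_(i | 0 < p i) v0 i.
have c0 : 0 < c by rewrite mulr_gt0//; apply: lt_bigmin.
have [] := @near_maximizer_gradient _ _ p K' c M s p0 p1 c0 s0.
- by case: K_neq0 => v Kv; exists (fun i => (1 - s) * v i + s * v0 i); exists v.
- move=> a _ _ a01 [u Ku <-] [v Kv <-].
  exists (fun i => (1 - a) * u i + a * v i); first exact: Kc.
  by apply/funext => i; ring.
- move=> v i K'v pi; have /andP[_ ->] := KM _ i (K'K _ K'v); rewrite andbT.
  case: K'v => u Ku <-; have /andP[ui _] := KM _ i Ku.
  apply: (@le_trans _ _ (s * v0 i)); last by rewrite lerDr mulr_ge0//; lra.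
  by rewrite ler_pM2l//; exact: bigmin_le_cond.
move=> u K'u hu.
have u0 i : 0 < p i -> 0 < u i.
  move=> pi; case: K'u => v Kv <-; have /andP[vi _] := KM _ i Kv.
  by have := v0P _ pi; nra.
pose k := (1 - s) / (1 + 2 * s).
have k0 : 0 < k by rewrite divr_gt0//; lra.
have thk : th < k by rewrite /k ltr_pdivlMr; [rewrite /s; nra|lra].
pose w i := if 0 < p i then k * (p i / u i) else s / (1 + 2 * s) / Q.
have w0 i : 0 < w i.
  rewrite /w; case: ifP => pi; first by rewrite mulr_gt0// divr_gt0// u0.
  by rewrite !divr_gt0//; lra.
exists w; split => //.
- move=> v Kv.
  have := hu _ (ex_intro2 _ _ v Kv erefl) => /= hv.
  apply: (@le_trans _ _ (\sum_i (1 + 2 * s)^-1 *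
     (p i * (((1 - s) * v i + s * v0 i) / u i) + s * (`|M| / Q)))).
    apply: ler_sum => i _.
    have /andP[vi0 _] := KM _ i Kv; have /andP[v0i _] := KM _ i Kv0.
    have MQ : 0 <= s * (`|M| / Q) 
      by apply: mulr_ge0; [exact: ltW|rewrite divr_ge0// ltW].
    rewrite /w; case: ifP => pi.
      have -> : k * (p i / u i) * v i =
          (1 + 2 * s)^-1 * (p i * ((1 - s) * v i / u i)).
        by rewrite /k; field; have := u0 _ pi; lra.
      rewrite ler_pM2l ?invr_gt0; last by lra.
      rewrite -[leLHS]addr0 lerD// ler_pM2l// ler_pM2r ?invr_gt0 ?u0//.
      by rewrite lerDl; apply: mulr_ge0 => //; exact: ltW.
    have -> : p i = 0 by apply/eqP; rewrite eq_le p0 andbT leNgt pi.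
    rewrite mul0r add0r.
    have -> : s / (1 + 2 * s) / Q * v i = (1 + 2 * s)^-1 * (s * (v i / Q)).
      by field; lra.
    rewrite ler_pM2l ?invr_gt0; last by lra.
    by rewrite ler_pM2l// ler_pM2r ?invr_gt0// vM.
  rewrite -mulr_sumr big_split/= cst_sum mulrC ler_pdivrMr; last by lra.
  have : #|I|%:R * (s * (`|M| / Q)) <= s.
    by rewrite mulrCA ger_pMr// mulrA ler_pdivrMr// mul1r /Q lerDl.
  lra.
- have -> : \sum_i p i * ln (w i) = \sum_i (p i * ln k - p i * ln (u i / p i)).
    apply: eq_bigr => i _; rewrite /w; case: ifP => pi; last first.
      have -> : p i = 0 by apply/eqP; rewrite eq_le p0 andbT leNgt pi.
      by rewrite !mul0r subr0.
    have up : 0 < u i / p i by rewrite divr_gt0// u0.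
    rewrite -[p i / u i]invf_div [ln (k * _)]lnM ?posrE ?invr_gt0//.
    by rewrite lnV ?posrE// mulrDr mulrN.
  rewrite sumrB -mulr_suml p1 mul1r.
  have := KS _ (K'K _ K'u) u0.
  have : S - S' < ln k by rewrite -[X in X < _]expRK ltr_ln ?posrE.
  lra.
Qed.

(** * Integrals of nonnegative real functions *)

Section Nonneg_integral.
Context (d : measure_display) (X : measurableType d) (R : realType).
Variable m : {measure set X -> \bar R}.

Lemma ae_le_integral_EFin (f g : X -> R) :
  measurable_fun [set: X] f -> measurable_fun [set: X] g ->
  (forall x, 0 <= f x) -> (forall x, 0 <= g x) ->
  (\forall x \ae m, f x <= g x) ->
  (\int[m]_x (f x)%:E <= \int[m]_x (g x)%:E)%E.
Proof.
move=> mf mg f0 g0 fg; apply: ae_ge0_le_integral => //.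
- by move=> x _; rewrite lee_fin.
- exact/measurable_EFinP.
- by move=> x _; rewrite lee_fin.
- exact/measurable_EFinP.
- by apply: filterS fg => x fgx _; rewrite lee_fin.
Qed.

Lemma integralZl_EFin (k : R) (f : X -> R) :
  measurable_fun [set: X] f -> (forall x, 0 <= f x) -> 0 <= k ->
  (\int[m]_x (k * f x)%:E = k%:E * \int[m]_x (f x)%:E)%E.
Proof.
move=> mf f0 k0; under eq_integral do rewrite EFinM.
rewrite ge0_integralZl ?lee_fin//; first exact/measurable_EFinP.
by move=> x _; rewrite lee_fin.
Qed.

Lemma integral_sum_EFin (I : Type) (s : seq I) (f : I -> X -> R) :
  (forall i, measurable_fun [set: X] (f i)) -> (forall i x, 0 <= f i x) ->
  (\int[m]_x (\sum_(i <- s) f i x)%:E = \sum_(i <- s) \int[m]_x (f i x)%:E)%E.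
Proof.
move=> mf f0; under eq_integral do rewrite -sumEFin.
rewrite (@ge0_integral_sum _ _ _ _ _ _ _ (fun i x => (f i x)%:E))//.
  by move=> i; exact/measurable_EFinP.
by move=> i x _; rewrite lee_fin.
Qed.

End Nonneg_integral.

Lemma measurable_fun_iter d (X : measurableType d) (f : X -> X) n :
  measurable_fun [set: X] f -> measurable_fun [set: X] (iter n f).
Proof.
move=> mf; elim: n => [|n IH] /=; first exact: measurable_id.
exact: (measurableT_comp mf IH).
Qed.

(** Some term is at least the mean.  This cruder form of the convexity of the
    exponential replaces Hoelder's inequality, at the cost of a factor [N]. *)
Lemma expR_mean_le_sum (R : realType) (N : nat) (a : 'I_N -> R) :
  (0 < N)%N ->
  expR (N%:R^-1 * \sum_r a r) <= \sum_r expR (a r).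
Proof.
move=> N0.
have [r ar] : exists r, N%:R^-1 * \sum_r a r <= a r.
  apply: contrapT => H.
  have : \sum_r a r < \sum_(r < N) (N%:R^-1 * \sum_r a r).
    apply: ltr_sum => [|r _].
      by apply/hasP; exists (Ordinal N0); rewrite ?mem_index_enum.
    by rewrite ltNge; apply/negP => h; apply: H; exists r.
  rewrite sumr_const card_ord -mulrnAl -mulr_natr mulVf ?mul1r ?ltxx//.
  by rewrite pnatr_eq0 -lt0n.
apply: (@le_trans _ _ (expR (a r))); first by rewrite ler_expR.
by rewrite (bigD1 r)//= lerDl sumr_ge0// => i _; exact: expR_ge0.
Qed.

(** * Iterating a weighted shift that contracts L1 *)

Section Shift.
Context (d : measure_display) (X : measurableType d) (R : realType).
Variables (m : {measure set X -> \bar R}) (alpha : X -> X).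
Hypothesis malpha : measurable_fun [set: X] alpha.
Local Notation measurable_real f := (measurable_fun [set: X] f).

Lemma measurable_iter_comp (f : X -> R) n :
  measurable_real f -> measurable_real (fun x => f (iter n alpha x)).
Proof. by move=> mf; apply: (measurableT_comp mf); exact: measurable_fun_iter. Qed.

(** A constant at least 1 makes the bounds by powers of [C] monotone in the
    exponent. *)
Lemma shift_bounded_ge0 : shift_bounded m alpha ->
  exists2 C : R, 1 <= C &
    forall f : X -> R, measurable_real f -> (forall x, 0 <= f x) ->
    (\int[m]_x (f (alpha x))%:E <= C%:E * \int[m]_x (f x)%:E)%E.
Proof.
move=> [C hC]; exists (Num.max 1 C); first by rewrite le_max lexx.
move=> f mf f0.
have I0 : (0 <= \int[m]_x (f x)%:E)%E by apply: integral_ge0 => x _; rewrite lee_fin.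
have C0 : 0 < Num.max 1 C by rewrite lt_max ltr01.
have [foo|fin] := eqVneq (\int[m]_x (f x)%:E)%E +oo%E.
  by rewrite foo gt0_muley ?leey// lte_fin.
have fL : f \in Lfun m 1.
  apply/Lfun1_integrable; apply/integrableP; split; first exact/measurable_EFinP.
  by under eq_integral do rewrite /= ger0_norm//; rewrite ltey.
have := hC (Lfun_Sub (lexx _) fL).
rewrite !Lnorm1/=.
under eq_integral do rewrite /= ger0_norm//.
under [X in (_ <= _ * X)%E -> _]eq_integral do rewrite /= ger0_norm//.
move=> /le_trans; apply; apply: lee_wpmul2r => //.
by rewrite lee_fin le_max lexx orbT.
Qed.

Section Bounded.
Variable C : R.
Hypothesis C1 : 1 <= C.
Hypothesis shiftC : forall f : X -> R,
    measurable_real f -> (forall x, 0 <= f x) ->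
    (\int[m]_x (f (alpha x))%:E <= C%:E * \int[m]_x (f x)%:E)%E.

Lemma integral_iter_le (f : X -> R) n :
  measurable_real f -> (forall x, 0 <= f x) ->
  (\int[m]_x (f (iter n alpha x))%:E <= (C ^+ n)%:E * \int[m]_x (f x)%:E)%E.
Proof.
move=> mf f0; elim: n => [|n IH]; first by rewrite expr0 mul1e.
under eq_integral do rewrite iterSr.
apply: (le_trans (shiftC (measurable_iter_comp n mf) (fun x => f0 _))).
by rewrite exprS EFinM -muleA lee_wpmul2l// lee_fin; apply: le_trans C1.
Qed.

(** Boundedness of the shift makes [alpha] nonsingular: preimages of null sets are
    null, as the indicator function of a null set shows. *)
Lemma ae_iter (P : X -> Prop) n :
  (\forall x \ae m, P x) -> \forall x \ae m, P (iter n alpha x).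
Proof.
move=> [A [mA A0 PA]]; exists (iter n alpha @^-1` A); split.
- by rewrite -[_ @^-1` _]setTI; exact: measurable_fun_iter.
- apply/eqP; rewrite eq_le measure_ge0 andbT -[X in m X]setIT.
  rewrite -integral_indic//; last first.
    by rewrite -[_ @^-1` _]setTI; exact: measurable_fun_iter.
  have /= := @integral_iter_le \1_A n (measurable_indic mA)
    (fun x => ler0n _ _).
  by rewrite (integral_indic _ measurableT mA) setIT A0 mule0.
- by move=> x /= nP; apply: PA.
Qed.

Variables (N : nat) (psi : X -> R) (b : R).
Hypothesis N0 : (0 < N)%N.
Hypothesis mpsi : measurable_real psi.
Hypothesis b1 : 1 <= b.
Hypothesis psib : \forall x \ae m, expR (psi x) <= b.
Hypothesis contraction : forall f : X -> R,
  measurable_real f -> (forall x, 0 <= f x) ->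
  (\int[m]_x (expR (psi x) * f (iter N alpha x))%:E <= \int[m]_x (f x)%:E)%E.

Definition sparse_sum (n : nat) (x : X) : R :=
  \sum_(j < n | (N %| j)%N) psi (iter j alpha x).

Lemma sparse_sum_rec n x : (0 < n)%N ->
  sparse_sum n x = psi x + sparse_sum (n - N) (iter N alpha x).
Proof.
move=> n0; rewrite /sparse_sum.
rewrite -(big_mkord (fun j => N %| j)%N (fun j => psi (iter j alpha x))).
rewrite -(big_mkord (fun j => N %| j)%N
  (fun j => psi (iter j alpha (iter N alpha x)))).
rewrite big_ltn_cond// dvdn0; congr (_ + _).
have [nN|Nn] := leqP n N.
  move: (nN); rewrite -subn_eq0 => /eqP ->; rewrite [RHS]big_geq//.
  rewrite big_nat_cond big1// => j /andP[/andP[j0 jn]] /dvdn_leq.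
  by lia.
rewrite (@big_cat_nat _ _ _ N)//=; last exact: ltnW.
rewrite big_nat_cond big1 ?add0r; last first.
  by move=> j /andP[/andP[j0 jn]] /dvdn_leq; lia.
rewrite -{1}[N]add0n big_addn; apply: eq_big => [j|j _].
  by rewrite dvdn_addl.
by rewrite iterD.
Qed.

Lemma measurable_cond_sum n (P : pred nat) (h : nat -> X -> R) :
  (forall j, measurable_real (h j)) ->
  measurable_real (fun x => \sum_(j < n | P j) h j x).
Proof.
move=> mh; under eq_fun do rewrite big_mkcond/=.
apply: (@measurable_sum _ _ _ _ _ _
  (fun (j : 'I_n) x => if P j then h j x else 0)).
by move=> j; case: (P j) => //; exact: measurable_cst.
Qed.

Lemma measurable_sparse_sum n : measurable_real (sparse_sum n).
Proof.
apply: (@measurable_cond_sum n (dvdn N) (fun j x => psi (iter j alpha x))) => j.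
exact: measurable_iter_comp.
Qed.

Lemma measurable_expR_mul (g f : X -> R) n : measurable_real g -> measurable_real f ->
  measurable_real (fun x => expR (g x) * f (iter n alpha x)).
Proof.
move=> mg mf; apply: measurable_funM; last exact: measurable_iter_comp.
exact: measurableT_comp.
Qed.

(** Induction by [N] steps: the contraction applied to the remaining integrand
    removes the factor at time 0.  The constant pays for the last, incomplete
    block of fewer than [N] steps. *)
Lemma integral_sparse_sum_le (f : X -> R) n :
  measurable_real f -> (forall x, 0 <= f x) ->
  (\int[m]_x (expR (sparse_sum n x) * f (iter n alpha x))%:E
    <= (b * C ^+ N)%:E * \int[m]_x (f x)%:E)%E.
Proof.
move=> mf f0.
have I0 : (0 <= \int[m]_x (f x)%:E)%E by apply: integral_ge0 => x _; rewrite lee_fin.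
have b0 : 0 <= b by exact: le_trans b1.
have C0 : 0 <= C by exact: le_trans C1.
have [k] := ubnP n; elim: k n => // k IH n nk.
have [->|n0] := posnP n.
  under eq_integral do rewrite /sparse_sum big_ord0 expR0 mul1r.
  rewrite -[leLHS]mul1e lee_wpmul2r// lee_fin.
  by rewrite -[leLHS]mul1r ler_pM// exprn_ege1.
have [nN|Nn] := ltnP n N.
  apply: (@le_trans _ _ (\int[m]_x (b * f (iter n alpha x))%:E)%E).
    apply: ae_le_integral_EFin.
    - exact/measurable_expR_mul/mf/measurable_sparse_sum.
    - by apply: measurable_funM; [exact: measurable_cst|exact: measurable_iter_comp].
    - by move=> x; rewrite mulr_ge0 ?expR_ge0.
    - by move=> x; rewrite mulr_ge0.
    - apply: filterS psib => x hx; rewrite sparse_sum_rec//.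
      have -> : (n - N = 0)%N by lia.
      by rewrite /sparse_sum big_ord0 addr0 ler_wpM2r.
  rewrite integralZl_EFin//; last exact: measurable_iter_comp.
  rewrite EFinM -muleA lee_wpmul2l ?lee_fin//.
  apply: (le_trans (integral_iter_le n mf f0)).
  by rewrite lee_wpmul2r// lee_fin ler_weXn2l// ltnW.
pose F y := expR (sparse_sum (n - N) y) * f (iter (n - N) alpha y).
have -> : (\int[m]_x (expR (sparse_sum n x) * f (iter n alpha x))%:E =
    \int[m]_x (expR (psi x) * F (iter N alpha x))%:E)%E.
  apply: eq_integral => x _; rewrite sparse_sum_rec// expRD -mulrA /F.
  by rewrite -iterD subnK.
apply: le_trans (IH (n - N)%N _); last by lia.
apply: contraction.
  exact/measurable_expR_mul/mf/measurable_sparse_sum.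
by move=> x; rewrite mulr_ge0 ?expR_ge0.
Qed.

Definition phase_sum (r n : nat) (x : X) : R :=
  \sum_(j < n | (j %% N == r)%N) psi (iter j alpha x).

Lemma measurable_phase_sum r n : measurable_real (phase_sum r n).
Proof.
apply: (@measurable_cond_sum n (fun j => j %% N == r)%N
  (fun j x => psi (iter j alpha x))) => j.
exact: measurable_iter_comp.
Qed.

Lemma phase_sumE r n x : (r < N)%N -> (r <= n)%N ->
  phase_sum r n x = sparse_sum (n - r) (iter r alpha x).
Proof.
move=> rN rn; rewrite /sparse_sum /phase_sum.
rewrite -(big_mkord (fun j => j %% N == r)%N (fun j => psi (iter j alpha x))).
rewrite -(big_mkord (fun j => N %| j)%N
  (fun j => psi (iter j alpha (iter r alpha x)))).
rewrite (@big_cat_nat _ _ _ r)//=.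
rewrite big_nat_cond big1 ?add0r; last first.
  by move=> j /andP[/andP[_ jr]] /eqP; rewrite modn_small; lia.
rewrite -{1}[r]add0n big_addn; apply: eq_big => [j|j _].
  rewrite -[in X in _ == X](modn_small rN) -[in X in _ == X](add0n r).
  by rewrite eqn_modDr mod0n.
by rewrite iterD.
Qed.

(** After [r] steps the class of [r] becomes the class of 0. *)
Lemma integral_phase_sum_le (f : X -> R) r n : (r < N)%N ->
  measurable_real f -> (forall x, 0 <= f x) ->
  (\int[m]_x (expR (phase_sum r n x) * f (iter n alpha x))%:E
    <= (C ^+ N * (b * C ^+ N))%:E * \int[m]_x (f x)%:E)%E.
Proof.
move=> rN mf f0.
have I0 : (0 <= \int[m]_x (f x)%:E)%E by apply: integral_ge0 => x _; rewrite lee_fin.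
have b0 : 0 <= b by exact: le_trans b1.
have C0 : 0 <= C by exact: le_trans C1.
have CN : 1 <= C ^+ N by exact: exprn_ege1.
have [rn|nr] := leqP r n.
  pose F y := expR (sparse_sum (n - r) y) * f (iter (n - r) alpha y).
  have -> : (\int[m]_x (expR (phase_sum r n x) * f (iter n alpha x))%:E =
      \int[m]_x (F (iter r alpha x))%:E)%E.
    by apply: eq_integral => x _; rewrite phase_sumE// /F -iterD subnK.
  apply: (le_trans (integral_iter_le r _ _)).
  - exact/measurable_expR_mul/mf/measurable_sparse_sum.
  - by move=> x; rewrite mulr_ge0 ?expR_ge0.
  - rewrite (EFinM (C ^+ N)) -muleA; apply: lee_pmul.
    + by rewrite lee_fin exprn_ge0.
    + by apply: integral_ge0 => x _; rewrite lee_fin mulr_ge0 ?expR_ge0.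
    + by rewrite lee_fin ler_weXn2l// ltnW.
    + exact: integral_sparse_sum_le.
have ph0 x : phase_sum r n x = 0.
  rewrite /phase_sum big1// => j /eqP; have jn := ltn_ord j.
  rewrite modn_small; lia.
under eq_integral do rewrite ph0 expR0 mul1r.
apply: (le_trans (integral_iter_le n mf f0)).
rewrite lee_wpmul2r// lee_fin; apply: (@le_trans _ _ (C ^+ N)).
  by rewrite ler_weXn2l//; lia.
by rewrite ler_peMr ?exprn_ge0// mulr_ege1.
Qed.

Lemma integral_birkhoff_le (f : X -> R) n :
  measurable_real f -> (forall x, 0 <= f x) ->
  (\int[m]_x (expR (N%:R^-1 * \sum_(j < n) psi (iter j alpha x))
              * f (iter n alpha x))%:E
    <= (N%:R * (C ^+ N * (b * C ^+ N)))%:E * \int[m]_x (f x)%:E)%E.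
Proof.
move=> mf f0.
apply: (@le_trans _ _ (\int[m]_x
    (\sum_(r < N) (expR (phase_sum r n x) * f (iter n alpha x)))%:E)%E).
  apply: ae_le_integral_EFin.
  - apply: (@measurable_expR_mul
      (fun x => N%:R^-1 * \sum_(j < n) psi (iter j alpha x))) => //.
    apply: measurable_funM; first exact: measurable_cst.
    by apply: measurable_sum => j; exact: measurable_iter_comp.
  - apply: measurable_sum => r; apply: measurable_expR_mul => //.
    exact: measurable_phase_sum.
  - by move=> x; rewrite mulr_ge0 ?expR_ge0.
  - by move=> x; rewrite sumr_ge0// => r _; rewrite mulr_ge0 ?expR_ge0.
  - apply: aeW => x; rewrite -mulr_suml ler_wpM2r//.
    have -> : \sum_(j < n) psi (iter j alpha x) = \sum_(r < N) phase_sum r n x.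
      by rewrite (partition_big (fun j : 'I_n => Ordinal (ltn_pmod j N0)) predT).
    exact: expR_mean_le_sum.
rewrite integral_sum_EFin; last 2 first.
- by move=> r; apply: measurable_expR_mul => //; exact: measurable_phase_sum.
- by move=> r x; rewrite mulr_ge0 ?expR_ge0.
apply: (@le_trans _ _ (\sum_(r < N)
    (C ^+ N * (b * C ^+ N))%:E * \int[m]_x (f x)%:E)%E).
  by apply: lee_sum => r _; exact: integral_phase_sum_le.
have I0 : (0 <= \int[m]_x (f x)%:E)%E by apply: integral_ge0 => x _; rewrite lee_fin.
have b0 : 0 <= b by exact: le_trans b1.
have C0 : 0 <= C by exact: le_trans C1.
rewrite -ge0_sume_distrl; last by move=> r _; rewrite lee_fin !mulr_ge0// exprn_ge0.
by rewrite sumEFin sumr_const card_ord mulr_natl.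
Qed.

End Bounded.
End Shift.

(** * From a partition of unity to a contracting weight *)

Lemma partition_le1 (R : realType) (I : finType) (u : I -> R) :
  (forall i, 0 <= u i) -> \sum_i u i = 1 -> forall i, u i <= 1.
Proof.
by move=> u0 <- i; rewrite (bigD1 i)//= lerDl sumr_ge0.
Qed.

(** Jensen's inequality: multiply by [g i] and sum the tangent-line bounds
    [w i >= expR y * (1 + (ln (w i) - y))], in which [y] is the mean of the
    [ln (w i)]. *)
Lemma exp_sum_ln_le (R : realType) (I : finType) (g w : I -> R) :
  (forall i, 0 <= g i) -> \sum_i g i = 1 -> (forall i, 0 < w i) ->
  expR (\sum_i ln (w i) * g i) <= \sum_i w i * g i.
Proof.
move=> g0 g1 w0; set y := \sum_i ln (w i) * g i.
have -> : expR y = \sum_i (expR y * (1 + (ln (w i) - y))) * g i.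
  under eq_bigr => i _ do rewrite -mulrA mulrDl mul1r mulrBl.
  rewrite -mulr_sumr big_split/= sumrB g1 -/y -mulr_sumr g1.
  by rewrite mulr1 subrr addr0 mulr1.
apply: ler_sum => i _; rewrite ler_wpM2r//.
rewrite -[leRHS]lnK ?posrE// -[in leRHS](subrK y (ln (w i))) expRD mulrC.
by rewrite ler_wpM2r ?expR_ge0// expR_ge1Dx.
Qed.

Section State.
Context (d : measure_display) (X : measurableType d) (R : realType).
Variable m : {measure set X -> \bar R}.
Local Notation measurable_real f := (measurable_fun [set: X] f).

Lemma Linfty_sumE (I : Type) (s : seq I) (a : I -> R) (g : I -> Linfty m) x :
  (\sum_(i <- s) a i *: g i : Linfty m) x = \sum_(i <- s) a i * g i x.
Proof.
elim: s => [|i s IH]; first by rewrite !big_nil.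
by rewrite !big_cons -IH.
Qed.

Variable mu : states m.

Lemma state_sum (I : Type) (s : seq I) (a : I -> R) (g : I -> Linfty m) :
  \val mu (\sum_(i <- s) a i *: g i : Linfty m) = \sum_(i <- s) a i * \val mu (g i).
Proof.
have [lin _ _] := set_valP mu.
have mu0 : \val mu (0 : Linfty m) = 0.
  by have := lin (-1) 0 0; rewrite scaler0 add0r mulN1r addNr.
elim: s => [|i s IH]; first by rewrite !big_nil.
by rewrite !big_cons -IH; exact: lin.
Qed.

Variables (I : finType) (g : I -> Linfty m).
Hypothesis g0 : forall i, \forall x \ae m, 0 <= g i x.
Hypothesis g1 : \forall x \ae m, \sum_i g i x = 1.

Lemma state_partition_sum : \sum_i \val mu (g i) = 1.
Proof.
have [_ _ <-] := set_valP mu.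
transitivity (\val mu (\sum_i 1 *: g i : Linfty m)).
  by rewrite state_sum; apply: eq_bigr => i _; rewrite mul1r.
apply: state_ae_eq; apply: filterS g1 => x gx.
by rewrite Linfty_sumE -[RHS]gx; apply: eq_bigr => i _; rewrite mul1r.
Qed.

Lemma partition_ae : \forall x \ae m, (forall i, 0 <= g i x) /\ \sum_i g i x = 1.
Proof. by apply: filterS2 (filter_forall _ g0) g1 => x; split. Qed.

(** The elements of a partition of unity are nonnegative only almost everywhere;
    these versions allow the theorems on integrals of nonnegative functions. *)
Definition posg i x := Num.max 0 (g i x).

Lemma posg_ge0 i x : 0 <= posg i x.
Proof. by rewrite /posg le_max lexx. Qed.

Lemma measurable_Linfty (f : Linfty m) : measurable_real f.
Proof. exact: measurable_funPT. Qed.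

Lemma measurable_posg i : measurable_real (posg i).
Proof.
by apply: measurable_maxr; [exact: measurable_cst|exact: measurable_Linfty].
Qed.

Lemma ae_posg : \forall x \ae m, forall i, posg i x = g i x.
Proof. by apply: filterS partition_ae => x [gx _] i; rewrite /posg max_r. Qed.

Variables (alpha : X -> X) (n : nat) (C S S' : R).
Hypothesis malpha : measurable_real alpha.
Hypothesis C1 : 1 <= C.
Hypothesis shiftC : forall f : X -> R,
    measurable_real f -> (forall x, 0 <= f x) ->
    (\int[m]_x (f (alpha x))%:E <= C%:E * \int[m]_x (f x)%:E)%E.
Hypothesis tauS : forall f : L1 m, 'N[m]_1[EFin \o f]%E = 1%E ->
  (\sum_i tau_summand alpha n (\val mu) f (g i) <= S%:E)%E.
Hypothesis SS' : S < S'.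

Local Notation J i f := (\int[m]_x (posg i x * f (iter n alpha x))%:E)%E.

Lemma measurable_mass i (f : X -> R) : measurable_real f ->
  measurable_real (fun x => posg i x * f (iter n alpha x)).
Proof.
move=> mf; apply: measurable_funM; first exact: measurable_posg.
exact: measurable_iter_comp.
Qed.

Lemma measurable_scale (k : R) (f : X -> R) :
  measurable_real f -> measurable_real (fun x => k * f x).
Proof. by move=> mf; apply: measurable_funM => //; exact: measurable_cst. Qed.

Lemma mass_ge0 i (f : X -> R) : (forall x, 0 <= f x) -> (0 <= J i f)%E.
Proof.
by move=> f0; apply: integral_ge0 => x _; rewrite lee_fin mulr_ge0// posg_ge0.
Qed.

Lemma mass_le i (f : X -> R) : measurable_real f -> (forall x, 0 <= f x) ->
  (J i f <= (C ^+ n)%:E * \int[m]_x (f x)%:E)%E.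
Proof.
move=> mf f0; apply: le_trans (integral_iter_le malpha C1 shiftC n mf f0).
apply: ae_le_integral_EFin.
- exact: measurable_mass.
- exact: measurable_iter_comp.
- by move=> x; rewrite mulr_ge0// posg_ge0.
- by move=> x.
- apply: (filterS2 _ _ partition_ae ae_posg) => x [gx sx] ->.
  by rewrite ler_piMl//; exact: (partition_le1 gx sx).
Qed.

(** The convex set on which the supremum in [tau_nD] is taken. *)
Definition masses : set (I -> R) :=
  [set v | exists f : X -> R, [/\ measurable_real f, forall x, 0 <= f x,
     (\int[m]_x (f x)%:E = 1)%E & forall i, (v i)%:E = J i f]].

Lemma masses_convex (s : R) (u v : I -> R) :
  0 <= s <= 1 -> masses u -> masses v ->
  masses (fun i => (1 - s) * u i + s * v i).
Proof.
move=> /andP[s0 s1] [f [mf f0 f1 fu]] [h [mh h0 h1 hv]].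
have s10 : 0 <= 1 - s by lra.
exists (fun x => (1 - s) * f x + s * h x); split.
- by apply: measurable_funD; exact: measurable_scale.
- by move=> x; rewrite addr_ge0// mulr_ge0.
- under eq_integral do rewrite EFinD.
  rewrite ge0_integralD//.
  + rewrite !integralZl_EFin// f1 h1 !mule1 -EFinD; congr (_%:E); ring.
  + by move=> x _; rewrite lee_fin mulr_ge0.
  + by apply/measurable_EFinP; exact: measurable_scale.
  + by move=> x _; rewrite lee_fin mulr_ge0.
  + by apply/measurable_EFinP; exact: measurable_scale.
- move=> i; rewrite EFinD !EFinM fu hv.
  rewrite -!integralZl_EFin//; last 4 first.
  + exact: measurable_mass.
  + by move=> x; rewrite mulr_ge0// posg_ge0.
  + exact: measurable_mass.
  + by move=> x; rewrite mulr_ge0// posg_ge0.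
  rewrite -ge0_integralD//.
  + by apply: eq_integral => x _; rewrite -EFinD; congr (_%:E); ring.
  + by move=> x _; rewrite lee_fin !mulr_ge0// posg_ge0.
  + by apply/measurable_EFinP; exact/measurable_scale/measurable_mass.
  + by move=> x _; rewrite lee_fin !mulr_ge0// posg_ge0.
  + by apply/measurable_EFinP; exact/measurable_scale/measurable_mass.
Qed.

Lemma masses_bounded v i : masses v -> 0 <= v i <= C ^+ n.
Proof.
move=> [f [mf f0 f1 fv]]; rewrite -!lee_fin fv mass_ge0//=.
by apply: (le_trans (mass_le i mf f0)); rewrite f1 mule1.
Qed.

Lemma masses_entropy_le v : masses v ->
  (forall i, 0 < \val mu (g i) -> 0 < v i) ->
  \sum_i \val mu (g i) * ln (v i / \val mu (g i)) <= S.
Proof.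
move=> [f [mf f0 f1 fv]] vpos; have [_ pos _] := set_valP mu.
have fL : f \in Lfun m 1.
  apply/Lfun1_integrable; apply/integrableP; split; first exact/measurable_EFinP.
  by under eq_integral do rewrite /= ger0_norm//; rewrite f1 ltry.
pose F : L1 m := Lfun_Sub (lexx _) fL.
rewrite -lee_fin; apply: le_trans (tauS (_ : 'N[m]_1[EFin \o F]%E = 1%E)); last first.
  by rewrite Lnorm1 -[RHS]f1; apply: eq_integral => x _ /=; rewrite ger0_norm.
rewrite -sumEFin; apply: lee_sum => i _; rewrite /tau_summand.
case: eqP => [->|/eqP p0]; first by rewrite mul0r.
have pi : 0 < \val mu (g i) by rewrite lt0r p0 pos.
have -> : (\int[m]_x (g i x * `|F (iter n alpha x)|)%:E = (v i)%:E)%E.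
  rewrite fv; apply: ae_eq_integral => //.
  - apply/measurable_EFinP; apply: measurable_funM; first exact: measurable_Linfty.
    by apply: measurableT_comp => //; exact: measurable_iter_comp.
  - by apply/measurable_EFinP; exact: measurable_mass.
  - by apply: filterS ae_posg => x /(_ i) gx _; rewrite gx/= ger0_norm.
by rewrite -EFinM lne_EFin ?mulr_gt0 ?invr_gt0 ?vpos// -EFinM.
Qed.

(** The dual weights of [masses] give [psi = \sum_i ln (w i) *: g i].  The
    contraction property for [f] of integral 1 is the bound of [w] on [masses];
    it scales to a finite positive integral, and an integral 0 forces all masses
    to vanish by [mass_le]. *)
Lemma state_contraction :
  exists (psi : Linfty m) (b : R), [/\ 1 <= b,
    \forall x \ae m, expR (psi x) <= b,
    - S' < \val mu psi &
    forall f : X -> R, measurable_real f -> (forall x, 0 <= f x) ->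
    (\int[m]_x (expR (psi x) * f (iter n alpha x))%:E <= \int[m]_x (f x)%:E)%E].
Proof.
have [_ pos _] := set_valP mu.
have [w [w0 w1 wS]] := dual_weights (fun i => pos (g i) (g0 i))
  state_partition_sum masses_convex masses_bounded masses_entropy_le SS'.
exists (\sum_i ln (w i) *: g i), (1 + \sum_i w i); split.
- by rewrite lerDl sumr_ge0// => i _; exact: ltW.
- apply: filterS partition_ae => x [gx sx]; rewrite Linfty_sumE.
  apply: (le_trans (exp_sum_ln_le gx sx w0)).
  apply: (@le_trans _ _ (\sum_i w i)); last by rewrite lerDr.
  apply: ler_sum => i _; rewrite ler_piMr ?(ltW (w0 i))//.
  exact: (partition_le1 gx sx).
- by rewrite state_sum; under eq_bigr do rewrite mulrC.
move=> f mf f0.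
have f_ge0 : (0 <= \int[m]_x (f x)%:E)%E.
  by apply: integral_ge0 => x _; rewrite lee_fin.
apply: (@le_trans _ _ (\sum_i (w i)%:E * J i f)%E).
  under [leRHS]eq_bigr => i _.
    rewrite -integralZl_EFin; [|exact: measurable_mass
      |by move=> x; rewrite mulr_ge0// posg_ge0|exact: ltW].
    over.
  rewrite -integral_sum_EFin; last 2 first.
  - by move=> i; exact/measurable_scale/measurable_mass.
  - by move=> i x; rewrite !mulr_ge0 ?posg_ge0// ltW.
  apply: ae_le_integral_EFin.
  - by apply: measurable_expR_mul => //; exact: measurable_Linfty.
  - apply: measurable_sum => i.
    by exact/measurable_scale/measurable_mass.
  - by move=> x; rewrite mulr_ge0// expR_ge0.
  - by move=> x; rewrite sumr_ge0// => i _; rewrite !mulr_ge0 ?posg_ge0// ltW.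
  - apply: (filterS2 _ _ partition_ae ae_posg) => x [gx sx] px; rewrite Linfty_sumE.
    under [leRHS]eq_bigr do rewrite mulrA px.
    by rewrite -mulr_suml ler_wpM2r// exp_sum_ln_le.
have [foo|fin] := eqVneq (\int[m]_x (f x)%:E)%E +oo%E; first by rewrite foo leey.
have [c cE] : exists c, (\int[m]_x (f x)%:E)%E = c%:E.
  by exists (fine (\int[m]_x (f x)%:E)%E); rewrite fineK// ge0_fin_numE// ltey.
have c0 : 0 <= c by rewrite -lee_fin -cE.
have [c00|cn0] := eqVneq c 0.
  rewrite cE c00 big1// => i _; have /eqP-> : J i f == 0%E; last by rewrite mule0.
  by rewrite eq_le mass_ge0// andbT; have := mass_le i mf f0; rewrite cE c00 mule0.
have Jfin i : J i f \is a fin_num.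
  rewrite ge0_fin_numE ?mass_ge0//; apply: (le_lt_trans (mass_le i mf f0)).
  by rewrite cE -EFinM ltry.
have : \sum_i w i * (c^-1 * fine (J i f)) <= 1.
  apply: (w1 (fun i => c^-1 * fine (J i f))).
  exists (fun x => c^-1 * f x); split.
  - exact: measurable_scale.
  - by move=> x; rewrite mulr_ge0// invr_ge0.
  - by rewrite integralZl_EFin ?invr_ge0// cE -EFinM mulVf.
  - move=> i; rewrite EFinM fineK//.
    rewrite -integralZl_EFin ?invr_ge0//; last 2 first.
    + exact: measurable_mass.
    + by move=> x; rewrite mulr_ge0// posg_ge0.
    by apply: eq_integral => x _; rewrite mulrCA.
under eq_bigr do rewrite mulrCA.
rewrite -mulr_sumr mulrC ler_pdivrMr ?mul1r; last by rewrite lt0r cn0.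
move=> h; rewrite cE.
under eq_bigr => i _ do rewrite -(fineK (Jfin i)) -EFinM.
by rewrite sumEFin lee_fin.
Qed.

End State.

(** * The neighbourhood and the integral estimate *)

Lemma nbhs_half_space (d : measure_display) (X : measurableType d) (R : realType)
    (m : {measure set X -> \bar R}) (mu : states m) (psi : Linfty m) (a : R) :
  a < \val mu psi ->
  nbhs mu (cylinder (fun _ : 'I_1 => psi) [set v | a < v 0 0]).
Proof.
move=> amu.
have ev : {for mu, continuous (fun nu : states m => \val nu psi)}.
  apply: (@continuous_comp _ _ _ (set_val : states m -> _) (proj psi)).
    exact: initial_continuous.
  exact: proj_continuous.
have amu' : nbhs (\val mu psi) [set x | a < x].
  by apply: open_nbhs_nbhs; split => //; exact: open_gt.
have H : nbhs mu [set nu : states m | a < \val nu psi] by exact: (ev _ amu').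
by apply: (filterS _ H) => nu /= h; rewrite /cylinder/= mxE.
Qed.

Theorem theorem2 (d : measure_display) (X : measurableType d) (R : realType)
    (m : {sigma_finite_measure set X -> \bar R}) (alpha : X -> X)
    (malpha : measurable_fun [set: X] alpha)
    (Abounded : shift_bounded m alpha)
    (mu : states m) (t : R) (mut : (tau alpha (\val mu) < t%:E)%E) :
  exists (k : nat) (g : 'I_k -> Linfty m) (W : set 'rV[R]_k) (C : R),
    [/\ open W,
        nbhs mu (cylinder g W) &
        forall h : 'I_k -> Linfty m,
          (forall i, \forall x \ae m, h i x = g i x) ->
        forall (f : L1 m) (n : nat), (0 < n)%N ->
          (\int[m]_(x in empirical_in alpha n h W) (f (iter n alpha x))%:E
           <= (C * expR (n%:R * t))%:E * \int[m]_x `|f x|%:E)%E].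
Proof.
have [C C1 shiftC] := shift_bounded_ge0 Abounded.
have [_ [N /= N0 <-]] := ereal_inf_lt mut.
have NR : (0 : R) < N%:R by rewrite ltr0n.
rewrite lte_pdivrMr// muleC -EFinM => /ereal_inf_lt[_ [D [D0 D1] <-]] tauD.
(* [tau_nD] may be [-oo], in which case any [S] will do. *)
have [S tauS SN] : exists2 S : R,
    (tau_nD alpha N (\val mu) D <= S%:E)%E & S < N%:R * t.
  case: (tau_nD alpha N (\val mu) D) tauD => [r|//|_] /=.
    by rewrite lte_fin => h; exists r.
  by exists (N%:R * t - 1); [rewrite leNye|lra].
have [||f fN|psi [b [b1 psib psimu contr]]] :=
  @state_contraction _ _ _ m mu D val _ _ alpha N C S _ malpha C1 shiftC _ SN.
- by move=> i; apply: D0; exact: valP.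
- by apply: filterS D1 => x; rewrite big_seq_fsetE.
- apply: le_trans tauS.
  rewrite -(big_seq_fsetE _ D predT (tau_summand alpha N (\val mu) f)).
  by apply: ereal_sup_ubound; exists f.
have mpsi : measurable_fun [set: X] psi by exact: measurable_funPT.
exists 1%N, (fun=> psi), [set v | - (N%:R * t) < v 0 0].
exists (N%:R * (C ^+ N * (b * C ^+ N))); split.
- apply: (@open_comp _ _ (fun v : 'rV[R]_1 => v 0 0) [set x | - (N%:R * t) < x]).
    by move=> v _; exact: coord_continuous.
  exact: open_gt.
- exact: nbhs_half_space.
move=> h hpsi f n n0.
have mf : measurable_fun [set: X] f by exact: measurable_funPT.
have nR : (0 : R) < n%:R by rewrite ltr0n.
set E := empirical_in _ _ _ _.
have EE x : E x <-> - (N%:R * t) < empirical alpha n x (h 0).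
  by rewrite /E /empirical_in/= mxE.
have mh : measurable_fun [set: X] (fun x => empirical alpha n x (h 0)).
  apply: measurable_funM; first exact: measurable_cst.
  have mh0 : measurable_fun [set: X] (h 0) by exact: measurable_funPT.
  apply: measurable_sum => i; exact: (measurable_iter_comp malpha i mh0).
have mE : measurable E.
  have -> : E = [set: X] `&`
      (fun x => empirical alpha n x (h 0)) @^-1` [set` `]- (N%:R * t), +oo[].
    by apply/seteqP; split => x; [move=> /EE Ex; split => //=|move=> -[_ /=]];
       rewrite in_itv/= andbT//; move=> ?; apply/EE.
  exact: mh.
pose F x := `|f (iter n alpha x)|.
have mF : measurable_fun [set: X] F.
  by apply: measurableT_comp => //; exact: measurable_iter_comp.
apply: (le_trans (lee_abs _)).
apply: (le_trans (le_abse_integral _ mE _)).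
  apply/measurable_EFinP; apply: measurable_funTS; exact: measurable_iter_comp.
have -> : (\int[m]_(x in E) `|(f (iter n alpha x))%:E|
    = \int[m]_x (\1_E x * F x)%:E)%E.
  rewrite integral_mkcond; apply: eq_integral => x _.
  by rewrite patchE indicE; case: (x \in E); rewrite ?mul1r ?mul0r.
pose B x := N%:R^-1 * \sum_(j < n) psi (iter j alpha x).
have mB : measurable_fun [set: X] B.
  apply: measurable_funM; first exact: measurable_cst.
  by apply: measurable_sum => j; exact: measurable_iter_comp.
apply: (@le_trans _ _
    (\int[m]_x (expR (n%:R * t) * (expR (B x) * F x))%:E)%E).
  apply: ae_le_integral_EFin.
  - by apply: measurable_funM => //; exact: measurable_indic.
  - apply: measurable_funM; first exact: measurable_cst.
    by apply: measurable_funM => //; exact: measurableT_comp.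
  - by move=> x; rewrite mulr_ge0// /F.
  - by move=> x; rewrite !mulr_ge0 ?expR_ge0// /F.
  (* Almost everywhere, [h 0] and [psi] agree along the orbit of [x].  On [E] this
     gives [- (n t) < B x], so that the indicator function of [E] is at most
     [expR (n t + B x)]. *)
  - have : \forall x \ae m, forall j : 'I_n,
        h 0 (iter j alpha x) = psi (iter j alpha x).
      apply: filter_forall => j.
      exact: (ae_iter malpha C1 shiftC (P := fun y => h 0 y = psi y) j (hpsi 0)).
    apply: filterS => x hx; rewrite mulrA ler_wpM2r ?/F//.
    rewrite -expRD indicE; have [|_] := boolP (x \in E); last by rewrite expR_ge0.
    rewrite inE => /EE; rewrite /empirical (eq_bigr _ (fun j _ => hx j)) => xE.
    rewrite -[leLHS]/(1 : R) -[leLHS]expR0 ler_expR /B.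
    move: xE; set s := \sum_(_ < _) _ => xE.
    rewrite ltr_pdivlMl// in xE.
    rewrite -(ler_pM2l NR) mulr0 mulrDr mulVKf ?gt_eqF//. lra.
rewrite integralZl_EFin ?expR_ge0//; last 2 first.
- by apply: measurable_funM => //; exact: measurableT_comp.
- by move=> x; rewrite mulr_ge0 ?expR_ge0// /F.
rewrite (mulrC (N%:R * _)) EFinM -muleA lee_wpmul2l ?lee_fin ?expR_ge0//.
apply: (integral_birkhoff_le malpha C1 shiftC N0 mpsi b1 psib contr
  (f := fun x => `|f x|)) => //.
exact: measurableT_comp.
Qed.
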